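(* Let $S$ be a stochastic flow on the Polish space $X$ over the probability space $(\Omega,\mathscr{F},\mathbb{P})$, and suppose that $A(t,\omega)\subseteq X$, $t\in\mathbb{R}$, $\omega\in\Omega$, is a family of nonempty sets which is compact and forward invariant, i.e. there exists a set $\Omega_0\in\mathscr{F}$ of full measure such that a) for each $x\in X$ and $t\in\mathbb{R}$ the map $\omega\mapsto d(x,A(t,\omega))$ is measurable (as a map from $(\Omega,\mathscr{F})$ to $\mathbb{R}$ with its Borel $\sigma$-algebra); b) for each $\omega\in\Omega_0$ and $t\in\mathbb{R}$ the set $A(t,\omega)$ is compact; c) for each $\omega\in\Omega_0$ and $s\le t$ we have $S(t,s;\omega)A(s,\omega)\subseteq A(t,\omega)$. Then there exists an evolution system of measures $\{\mu_t\}_{t\in\mathbb{R}}$ for $(S(t,s;\omega))_{t\ge s,\ \omega\in\Omega}$ such that $\mu_t$ is supported by $A(t,\omega)$, i.e. for each $t\in\mathbb{R}$ we have $\mu_{t\omega}(A(t,\omega))=1$ for $\mathbb{P}$-a.e. $\omega$.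
   Context: $(\Omega,\mathscr{F},\mathbb{P})$ is a probability space, $(X,d)$ a Polish (complete separable metric) space with Borel $\sigma$-algebra $\mathscr{B}(X)$; $d(x,A)=\inf_{y\in A}d(x,y)$. Stochastic flow: a family of maps $S(t,s;\omega):X\to X$, $-\infty<s\le t<\infty$, $\omega\in\Omega$, such that for $\mathbb{P}$-a.e. $\omega$: (i) $S(t,r;\omega)S(r,s;\omega)=S(t,s;\omega)$ for all $s\le r\le t$; (ii) $x\mapsto S(t,s;\omega)x$ is continuous for all $s\le t$; (iii) for all $t\in\mathbb{R}$, $x\in X$ the mapping $(s,\omega)\mapsto S(t,s;\omega)x$ is measurable from $((-\infty,t]\times\Omega,\mathscr{B}((-\infty,t])\otimes\mathscr{F})$ to $(X,\mathscr{B}(X))$; (iv) $S(t,t;\omega)=\mathrm{id}_X$ for all $t\in\mathbb{R}$. A probability measure $\mu$ on $(\Omega\times X,\mathscr{F}\otimes\mathscr{B}(X))$ with marginal $\mathbb{P}$ on $\Omega$ has a disintegration $\mu_\omega$: each $\mu_\omega$ is a Borel probability measure on $X$, $\omega\mapsto\mu_\omega(B)$ is measurable for all $B\in\mathscr{B}(X)$, and $\mu(A\times B)=\int 1_A\,\mu_\omega(B)\,d\mathbb{P}(\omega)$ for $A\in\mathscr{F}$, $B\in\mathscr{B}(X)$. The disintegration of $\mu_t$ is written $\mu_{t\omega}$. An evolution system of measures for the stochastic flow $S$ is a family $\{\mu_s\}_{s\in\mathbb{R}}$ of probability measures on $(\Omega\times X,\mathscr{F}\otimes\mathscr{B}(X))$,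 each with marginal $\mathbb{P}$ on $\Omega$, such that $S(t,s;\cdot)\mu_s=\mu_t$ for all $s\le t$, where $S(t,s;\cdot)\mu_s$ is the image of $\mu_s$ under the map $(\omega,x)\mapsto(\omega,S(t,s;\omega)x)$. *)

(* Defs.v *)
From HB Require Import structures.
From mathcomp Require Import all_boot all_order all_algebra.
From mathcomp Require Import all_classical all_reals all_analysis.

Set Implicit Arguments.
Unset Strict Implicit.
Unset Printing Implicit Defensive.

Import Order.TTheory GRing.Theory Num.Theory.
Import numFieldNormedType.Exports.

Local Open Scope classical_set_scope.
Local Open Scope ring_scope.
Local Open Scope ereal_scope.

#[short(type="completeMetricType")]
HB.structure Definition CompleteMetric (R : realType) :=
  {T of Metric R T & Complete T}.

Definition separable (T : topologicalType) : Prop :=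
  exists2 D : set T, countable D & dense D.

(* The type X equipped with its Borel sigma-algebra. *)
Definition borel (X : ptopologicalType) : measurableType _ :=
  g_sigma_algebraType (@open X).

Definition dist_set (R : realType) (X : metricType R) (x : X) (A : set X) : R :=
  inf [set mdist x y | y in A].

(* S t s w x stands for S(t,s;w)x. It is a total function, but only its values
   for s <= t are constrained or used. A single null set is exceptional for
   (i), (ii), (iv), uniformly in the times; (iii) is not a condition on a fixed
   w and is required as it stands. *)
Record stochastic_flow d (Omega : measurableType d) (R : realType)
    (P : probability Omega R) (X : completeMetricType R)
    (S : R -> R -> Omega -> X -> X) : Prop := {
  flow_ae : {ae P, forall w,
    [/\ forall s r t : R, (s <= r)%R -> (r <= t)%R ->
          S t r w \o S r s w = S t s w,
        forall s t : R, (s <= t)%R -> continuous (S t s w)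
      & forall t : R, S t t w = id]};
  flow_measurable : forall (t : R) (x : X),
    measurable_fun (`]-oo, t] `*` setT : set (R * Omega))
      (fun p => S t p.1 p.2 x : borel X) }.

(* nu is the image of mu under f, where f need only agree mu-a.e. with a
   measurable map g. The choice of g does not matter, and for measurable f this
   says that nu = pushforward mu f on measurable sets. The plain pushforward
   is not usable for (w, x) |-> (w, S(t,s;w)x): off the full-measure set of
   good w that map need not be jointly measurable, and a measure has
   unspecified values on non-measurable sets. *)
Definition is_image d1 d2 (T1 : measurableType d1) (T2 : measurableType d2)
    (R : realType) (mu : probability T1 R) (f : T1 -> T2)
    (nu : probability T2 R) : Prop :=
  exists g : T1 -> T2,
    [/\ measurable_fun setT g,
        {ae mu, forall z, f z = g z}
      & forall C, measurable C -> nu C = pushforward mu g C].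

Record evolution_system d (Omega : measurableType d) (R : realType)
    (P : probability Omega R) (X : completeMetricType R)
    (S : R -> R -> Omega -> X -> X)
    (mu : R -> probability (Omega * borel X)%type R) : Prop := {
  evolution_marginal : forall (s : R) (A : set Omega), measurable A ->
    pushforward (mu s) fst A = P A;
  evolution_image : forall s t : R, (s <= t)%R ->
    is_image (mu s)
      (fun p : Omega * borel X => (p.1, S t s p.1 p.2) : Omega * borel X)
      (mu t) }.

Definition disintegration d (Omega : measurableType d) (R : realType)
    (P : probability Omega R) (X : completeMetricType R)
    (mu : probability (Omega * borel X)%type R)
    (m : R.-pker Omega ~> borel X) : Prop :=
  forall (A : set Omega) (B : set (borel X)), measurable A -> measurable B ->
    mu (A `*` B) = \int[P]_w ((\1_A w)%:E * m w B).

(* A disintegration is unique only up to null sets, so the condition is asked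
   of every version, together with the existence of one. *)
Definition supported_by d (Omega : measurableType d) (R : realType)
    (P : probability Omega R) (X : completeMetricType R)
    (mu : probability (Omega * borel X)%type R) (A : Omega -> set X) : Prop :=
  (exists m, disintegration P mu m) /\
  (forall m, disintegration P mu m -> {ae P, forall w, m w (A w) = 1}).

(* Main.v *)
Require Import Defs.
From HB Require Import structures.
From mathcomp Require Import all_boot all_order all_algebra.
From mathcomp Require Import all_classical all_reals all_analysis.
From mathcomp Require Import measurable_realfun lra.

Set Implicit Arguments.
Unset Strict Implicit.
Unset Printing Implicit Defensive.

Import Order.TTheory GRing.Theory Num.Theory.
Import numFieldNormedType.Exports.

Local Open Scope classical_set_scope.
Local Open Scope ring_scope.
Local Open Scope ereal_scope.

(** The evolution system can be taken to consist of random Dirac measures, so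
that everything reduces to a measurable choice of an entire trajectory.

For a fixed good [w], the sets [A (-n) w] with the maps [S (-n) (-(n+1)) w]
form an inverse system of nonempty compact spaces, whose limit is nonempty by
compactness. A point of the limit is a sequence [y n w] in [A (-n) w] with
[S (-n) (-m) w (y m w) = y n w] for [n <= m]; pushing it forward from a
sufficiently early integer time gives a complete trajectory [t |-> Y t w] with
[Y t w] in [A t w], indexed by all real times. If [Y t] is measurable in [w],
then the law [mu t] of [w |-> (w, Y t w)] has marginal [P] and disintegration
[dirac (Y t w)], it is supported by [A t], and it is transported by the flow
because [mu s] lives on the graph of [Y s].

The substance is therefore [measurable_inverse_limit]. Its proof uses a notion
of random compact set that is stable under all the constructions involved:
[K w] is compact, nonempty, and the infimum over [K w] of any nonnegative
Caratheodory function (continuous in [x], measurable in [w]) depends measurably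
on [w].
- A compact set with measurable distance functions is random compact: over a
  dense sequence, the infimum of [g + n * dist (., K w)] converges to the
  infimum of [g] over [K w] as [n] grows ([random_compact_dist]). Applied to
  singletons, this also gives the measurability of [w |-> g w (y w)].
- The minimizers over [K] of a Caratheodory function [f] form a random compact
  set, by the same penalization with [|f - inf f|] ([random_compact_argmin]).
- Decreasing intersections and images under random continuous maps stay random
  compact ([random_compact_bigcap], [random_compact_image]).
- Successively minimizing the distances to the points of a dense sequence
  shrinks [K w] to one point, which is a measurable selection
  ([random_compact_selection]).
Let [I n w] be the intersection over [k] of the images of [A (-n-k) w] at time
[-n]. It is random compact, and [f n w = S (-n) (-(n+1)) w] sends [I n.+1 w]
onto [I n w]. Hence a trajectory is selected step by step: [y n.+1] is a
selection of the minimizers over [I n.+1] of the distance from [f n w x] to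
[y n w], where the minimum is zero.

Since a disintegration is only determined up to null sets, the support property
needs an argument for every version: a countable family of Borel sets that
separates points shows that any disintegration of [mu t] is almost surely
carried by the single point [Y t w] ([disintegration_graph]). *)

(** * Infima over compact sets *)

Definition infval (R : realType) (T : Type) (g : T -> R) (K : set T) : R :=
  inf (g @` K).

Section infval.
Context {R : realType} {T : Type}.
Implicit Types (g h : T -> R) (K E : set T).
Local Open Scope ring_scope.

Lemma infval_le g K x : (forall x, 0 <= g x) -> K x -> infval g K <= g x.
Proof.
move=> g0 Kx; apply: ge_inf; last by exists x.
by exists 0 => _ [y _ <-].
Qed.

Lemma le_infval g K c : K !=set0 -> (forall x, K x -> c <= g x) ->
  c <= infval g K.
Proof.
move=> [x Kx] cg; apply: lb_le_inf; first by exists (g x), x.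
by move=> _ [y Ky <-]; exact: cg.
Qed.

Lemma infval_lt g K c : K !=set0 -> infval g K < c ->
  exists2 x, K x & g x < c.
Proof.
move=> [x Kx] /inf_lt[|_ [y Ky <-] yc]; first by exists (g x), x.
by exists y.
Qed.

(** Penalization: as the weight [n] of the penalty [h] grows, minimizing
[g + n * h] over [E] approaches [c], provided that [c] is almost reached at
almost no penalty, and that points of small penalty have [g] not much below
[c]. The last hypothesis is where compactness enters in the applications. *)
Lemma infval_penalty_cvg g h E c :
    (forall x, 0 <= g x) -> (forall x, 0 <= h x) ->
    (forall (n : nat) e, 0 < e -> exists2 x, E x & g x + n%:R * h x < c + e) ->
    (forall e, 0 < e -> \forall n \near \oo,
       forall x, E x -> h x < n.+1%:R^-1 -> c - e < g x) ->
  infval (fun x => g x + n%:R * h x) E @[n --> \oo] --> c.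
Proof.
move=> g0 h0 upper lower; apply/cvgrPdist_le => e e0.
have [N _ HN] := lower e e0.
have E0 : E !=set0 by have [x Ex _] := upper 0%N 1 ltr01; exists x.
near=> n; rewrite ler_distl; apply/andP; split.
  suff : infval (fun x => g x + n%:R * h x) E <= c by move=> ?; lra.
  apply/ler_addgt0Pr => d d0.
  have [x Ex xc] := upper n d d0.
  apply: le_trans (ltW xc); apply: infval_le => // y.
  by rewrite addr_ge0// mulr_ge0.
suff : c - e <= infval (fun x => g x + n%:R * h x) E by move=> ?; lra.
apply: le_infval => // x Ex.
have [hx|hx] := ltP (h x) N.+1%:R^-1.
  have := HN N (leqnn _) x Ex hx; have : 0 <= n%:R * h x by rewrite mulr_ge0.
  by lra.
(* Off the region of small penalty, [h x >= N.+1%:R^-1], so that the choice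
   [n >= c * N.+1] makes the penalty alone exceed [c]. *)
have : c <= n%:R * h x.
  apply: (@le_trans _ _ (c * N.+1%:R * N.+1%:R^-1)); first by rewrite mulfK.
  apply: (@le_trans _ _ (n%:R * N.+1%:R^-1)).
    rewrite ler_wpM2r//; near: n; exact: nbhs_infty_ger.
  by rewrite ler_wpM2l.
by have := g0 x; lra.
Unshelve. all: by end_near. Qed.

End infval.

Section compact_sequences.
Context {R : realType} {X : metricType R}.
Implicit Types (K : nat -> set X).
Local Open Scope ring_scope.

(** The form of the finite intersection property used below: a point outside
the intersection has a neighbourhood that eventually misses the [K n], which
feeds the near covering characterization of compactness. *)
Lemma near_notin_decreasing K x :
    (forall n, compact (K n)) -> (forall n, K n.+1 `<=` K n) ->
    ~ (\bigcap_n K n) x ->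
  \forall x' \near x & n \near \oo, ~ K n x'.
Proof.
move=> Kc Kd /existsNP[m /not_implyP[_ Kmx]].
have Kdec n : (m <= n)%N -> K n `<=` K m.
  elim: n => [|n IH]; first by rewrite leqn0 => /eqP ->.
  rewrite leq_eqVlt => /predU1P[->//|mn].
  by apply: subset_trans (Kd n) _; exact: IH.
have clK : closed (K m).
  by apply: compact_closed (Kc m); exact: metric_hausdorff.
have oK : \forall x' \near x, ~ K m x'.
  by apply: open_nbhs_nbhs; split => //; exact: closed_openC.
exists (~` K m, [set n | (m <= n)%N]).
  by split => //; exact: nbhs_infty_ge.
by move=> [x' n]/= [nKx mn] /(Kdec n mn).
Qed.

Lemma bigcap_decreasing_neq0 K :
    (forall n, compact (K n)) -> (forall n, K n !=set0) ->
    (forall n, K n.+1 `<=` K n) ->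
  \bigcap_n K n !=set0.
Proof.
move=> Kc K0 Kd; apply/set0P/negP => /eqP I0.
have := proj1 (compact_near_coveringP (K 0%N)) (Kc 0%N) nat \oo
  (fun n x => ~ K n x) _ _.
case=> [x _|N _ /(_ N (leqnn N)) KN].
  by apply: near_notin_decreasing => //; rewrite I0.
have [x KNx] := K0 N; apply: (KN x) => //.
elim: N x KNx {KN} => // n IH x /Kd; exact: IH.
Qed.

Lemma infval_bigcap_cvg K (g : X -> R) :
    (forall n, compact (K n)) -> (forall n, K n !=set0) ->
    (forall n, K n.+1 `<=` K n) ->
    (forall x, 0 <= g x) -> continuous g ->
  infval g (K n) @[n --> \oo] --> infval g (\bigcap_n K n).
Proof.
move=> Kc K0 Kd g0 cg; apply/cvgrPdist_le => e e0.
set c := infval g (\bigcap_n K n).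
have := proj1 (compact_near_coveringP (K 0%N)) (Kc 0%N) nat \oo
  (fun n x => K n x -> c - e < g x) _ _.
case=> [x _|N _ HN].
  have [Ix|/(near_notin_decreasing Kc Kd)] := pselect ((\bigcap_n K n) x).
    have : \forall x' \near x, c - e < g x'.
      have cx : c - e < g x by have := infval_le g0 Ix; rewrite -/c; lra.
      exact: (cvgr_gt (g x) (cg x)).
    move=> H; exists ([set x' | c - e < g x'], setT) => /=.
      by split => //; exact: filterT.
    by move=> [x' n]/= [].
  by apply: filterS => -[x' n] /= nK /nK.
have K0n n : K n `<=` K 0%N.
  by elim: n => // n IH; exact: subset_trans (Kd n) IH.
near=> n; rewrite ler_distl; apply/andP; split.
  suff : infval g (K n) <= c by lra.
  apply: le_infval; first exact: bigcap_decreasing_neq0.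
  by move=> x Ix; apply: infval_le => //; exact: Ix.
suff : c - e <= infval g (K n) by lra.
apply: le_infval => // x Kx; apply: ltW.
apply: (HN n) => //; last exact: K0n Kx.
by rewrite /=; near: n; exact: nbhs_infty_ge.
Unshelve. all: by end_near. Qed.

Lemma lip_continuous (f : X -> R) :
  (forall x y, f y <= f x + mdist x y) -> continuous f.
Proof.
move=> lip x; apply/cvgrPdist_lt => e e0.
have : \forall y \near x, ball x e y by exact: nbhsx_ballx.
apply: filterS => y; rewrite ballEmdist/= => xy.
rewrite ltr_distl; have := lip x y; have := lip y x.
by rewrite (metric_sym y x); move: xy; lra.
Qed.

Lemma mdist_continuous (a : X) : continuous (mdist a).
Proof. by apply: lip_continuous => x y; exact: metric_triangle. Qed.

End compact_sequences.

(** * Random compact sets *)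

Section random_compact.
Context {R : realType} {d : measure_display} {Omega : measurableType d}.
Context {X : completeMetricType R} {a : nat -> X}.
Hypothesis dense_a : dense (range a).
Implicit Types (g : Omega -> X -> R) (K : Omega -> set X) (y : Omega -> X).
Local Open Scope ring_scope.

(** Nonnegativity is part of the notion so that every infimum below is one of a
set bounded from below. *)
Record caratheodory g : Prop := {
  caratheodory_continuous : forall w, continuous (g w);
  caratheodory_measurable : forall x, measurable_fun setT (g ^~ x);
  caratheodory_ge0 : forall w x, 0 <= g w x }.

(** Measurability of a random set is expressed by its infima rather than by
hitting sets: infima behave well under penalization, intersections and images.
*)
Record random_compact K : Prop := {
  random_compact_compact : forall w, compact (K w);
  random_compact_neq0 : forall w, K w !=set0;
  random_compact_infval : forall g, caratheodory g ->
    measurable_fun setT (fun w => infval (g w) (K w)) }.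

Lemma dense_near (x : X) (P : set X) : (\forall y \near x, P y) ->
  exists k, P (a k).
Proof.
move=> xP; have [||y [/interior_subset Py [k _ ky]]] := @dense_a P^°.
- by exists x.
- exact: open_interior.
by exists k; rewrite ky.
Qed.

Lemma caratheodory_mdist (x : X) : caratheodory (fun=> mdist x).
Proof.
split => [_|y|_ y]; [exact: mdist_continuous|exact: measurable_cst|].
exact: mdist_ge0.
Qed.

Lemma infval_attained g K w : caratheodory g -> compact (K w) -> K w !=set0 ->
  exists2 x, K w x & infval (g w) (K w) = g w x.
Proof.
move=> cg Kc K0.
have [|x /set_mem Kx xmin] := @compact_EVT_min _ _ (g w) _ K0 Kc.
  by apply: continuous_subspaceT; exact: caratheodory_continuous.
exists x => //; apply/eqP; rewrite eq_le infval_le//=; last first.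
  exact: caratheodory_ge0.
by apply: le_infval => // y Ky; apply: xmin; exact/mem_set.
Qed.

Lemma dist_set_ge0 (x : X) (A : set X) : A !=set0 -> 0 <= dist_set x A.
Proof. by move=> A0; apply: le_infval => // y _; exact: mdist_ge0. Qed.

Lemma dist_set_le (x y : X) (A : set X) : A y -> dist_set x A <= mdist x y.
Proof. by move=> Ay; apply: infval_le => // z; exact: mdist_ge0. Qed.

(** Here the penalty is the distance to [K w], which is known to be measurable
at each fixed point; by continuity of [g w] the infimum can be taken over the
countable dense sequence. *)
Lemma random_compact_dist K :
    (forall w, compact (K w)) -> (forall w, K w !=set0) ->
    (forall x, measurable_fun setT (fun w => dist_set x (K w))) ->
  random_compact K.
Proof.
move=> Kc K0 mK; split => // g cg.
pose h (n : nat) w :=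
  infval (fun x => g w x + n%:R * dist_set x (K w)) (range a).
have lb w n x : 0 <= g w x + n%:R * dist_set x (K w).
  by rewrite addr_ge0 ?mulr_ge0 ?dist_set_ge0//; exact: caratheodory_ge0.
apply: (@measurable_fun_cvg _ _ _ _ h) => [n|w _].
  pose u k w := g w (a k) + n%:R * dist_set (a k) (K w).
  rewrite (_ : h n = fun w => infs (u ^~ w) 0%N); last first.
    apply/funext => w; congr inf; apply/seteqP; split.
      by move=> _ [_ [k _ <-] <-]; exists k.
    by move=> _ [k _ <-]; exists (a k) => //; exists k.
  apply: measurable_fun_infs => [w _|k].
    by exists 0 => _ [k _ <-]; exact: lb.
  apply: measurable_funD; first exact: caratheodory_measurable.
  by apply: measurable_funM => //; exact: mK.
apply: infval_penalty_cvg.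
- exact: caratheodory_ge0.
- by move=> x; exact: dist_set_ge0.
- move=> n e e0; have [x Kx ->] := infval_attained cg (Kc w) (K0 w).
  have [k [gk xk]] : exists k, g w (a k) < g w x + e / 2 /\
      mdist x (a k) < (e / 2) / n.+1%:R.
    apply: (@dense_near x (fun z => g w z < g w x + e / 2 /\
      mdist x z < (e / 2) / n.+1%:R)).
    apply: filterI.
      apply: (cvgr_lt (g w x) (caratheodory_continuous cg (w:=w) (x:=x))).
      by rewrite ltrDl divr_gt0.
    have : \forall z \near x, ball x ((e / 2) / n.+1%:R) z.
      by apply: nbhsx_ballx; rewrite !divr_gt0.
    by apply: filterS => z; rewrite ballEmdist.
  exists (a k); first by exists k.
  have : n%:R * dist_set (a k) (K w) <= e / 2.
    apply: (@le_trans _ _ (n.+1%:R * ((e / 2) / n.+1%:R))); last first.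
      by rewrite mulrC divfK.
    apply: ler_pM; rewrite ?dist_set_ge0 ?ler_nat//.
    apply: le_trans (ltW xk); rewrite metric_sym; exact: dist_set_le.
  lra.
- move=> e e0; set c := infval _ _.
  have := proj1 (compact_near_coveringP (K w)) (Kc w) nat \oo
    (fun n x => forall z, mdist x z < n.+1%:R^-1 -> c - e < g w z) _ _.
  case=> [x Kx|N _ HN].
    have : \forall z \near x, c - e < g w z.
      apply: (cvgr_gt (g w x) (caratheodory_continuous cg (w:=w) (x:=x))).
      have := infval_le (caratheodory_ge0 cg w) Kx; rewrite -/c; lra.
    move=> /nbhs_ballP[r /= r0 rx].
    exists (ball x (r / 2), [set n | n.+1%:R^-1 < r / 2]).
      split => /=; first by apply: nbhsx_ballx; rewrite divr_gt0.
      have r20 : 0 < r / 2 by rewrite divr_gt0.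
      exact: (near_infty_natSinv_lt (PosNum r20)).
    move=> [x' n]/= [xx' nr] z x'z; apply: rx.
    apply: (ball_split xx'); rewrite ballEmdist/=; exact: lt_trans x'z nr.
  exists N => // n Nn x _ xK; have [z Kz xz] := infval_lt (K0 w) xK.
  by apply: (HN n Nn z Kz); rewrite metric_sym.
Qed.

(** The point [y w] is the random compact set [[set y w]], over which the
infimum of [g w] is [g w (y w)]. *)
Lemma caratheodory_comp g y : caratheodory g ->
    (forall x, measurable_fun setT (fun w => mdist x (y w))) ->
  measurable_fun setT (fun w => g w (y w)).
Proof.
move=> cg my; have [_ _ /(_ _ cg)] : random_compact (fun w => [set y w]).
  apply: random_compact_dist => [w|w|x]; first exact: compact_set1.
    by exists (y w).
  apply: eq_measurable_fun (my x) => w _.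
  by rewrite /dist_set image_set1 inf1.
by apply: eq_measurable_fun => w _; rewrite /infval image_set1 inf1.
Qed.

(** The penalty [`|f w x - infval (f w) (K w)|] vanishes on [K w] exactly at
the minimizers, and is itself Caratheodory because the minimal value is
measurable in [w]. The absolute value keeps it nonnegative outside [K w]. *)
Lemma random_compact_argmin K (f : Omega -> X -> R) :
    random_compact K -> caratheodory f ->
  random_compact (fun w => [set x | K w x /\ f w x = infval (f w) (K w)]).
Proof.
move=> [Kc K0 mK] cf.
set J := fun w => _.
have J0 w : J w !=set0.
  by have [x Kx fx] := infval_attained cf (Kc w) (K0 w); exists x.
have Jc w : compact (J w).
  apply: compact_closedI (Kc w) _.
  apply: (@closed_comp _ _ (f w) [set infval (f w) (K w)]).
    by move=> x _; exact: caratheodory_continuous.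
  exact: closed_eq.
split=> // g cg.
pose p w x := `|f w x - infval (f w) (K w)|.
apply: (@measurable_fun_cvg _ _ _ _
    (fun n w => infval (fun x => g w x + n%:R * p w x) (K w))).
  move=> n; apply: (mK); split => [w x|x|w x].
  - apply: cvgD; first exact: caratheodory_continuous.
    apply: cvgMr; apply: cvg_norm; apply: cvgB; last exact: cvg_cst.
    exact: caratheodory_continuous.
  - apply: measurable_funD; first exact: caratheodory_measurable.
    apply: measurable_funM => //; apply: measurableT_comp => //.
    by apply: measurable_funB; [exact: caratheodory_measurable|exact: mK].
  - by rewrite addr_ge0 ?mulr_ge0 ?normr_ge0 ?ler0n ?(caratheodory_ge0 cg).
move=> w _; apply: infval_penalty_cvg.
- exact: caratheodory_ge0.
- by move=> x; exact: normr_ge0.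
- move=> n e e0; have [x [Kx fx] ->] := infval_attained cg (Jc w) (J0 w).
  by exists x => //; rewrite /p fx subrr normr0 mulr0 addr0 ltrDl.
- move=> e e0; set c := infval (g w) _.
  have := proj1 (compact_near_coveringP (K w)) (Kc w) nat \oo
    (fun n x => p w x < n.+1%:R^-1 -> c - e < g w x) _ _.
  case=> [x Kx|N _ HN]; last by exists N => // n Nn x Kx; exact: HN.
  have [px0|px0] := eqVneq (p w x) 0.
    exists ([set z | c - e < g w z], setT); last by move=> [z n] /= [].
    split; last exact: filterT.
    apply: (cvgr_gt (g w x) (caratheodory_continuous cg (w:=w) (x:=x))).
    have Jx : J w x by split => //; exact: subr0_eq (normr0_eq0 px0).
    have := infval_le (caratheodory_ge0 cg w) Jx; rewrite -/c; lra.
  have p2 : 0 < p w x / 2 by rewrite divr_gt0// lt_neqAle eq_sym px0 normr_ge0.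
  exists ([set z | p w x / 2 < p w z], [set n | n.+1%:R^-1 < p w x / 2]).
    split; last exact: (near_infty_natSinv_lt (PosNum p2)).
    apply: (@cvgr_gt _ _ (nbhs x) _ (p w) (p w x)); last by move: p2; lra.
    apply: cvg_norm; apply: cvgB; last exact: cvg_cst.
    exact: caratheodory_continuous.
  move=> [z n]/= [pz np] zn; have := lt_trans (lt_trans pz zn) np.
  by rewrite ltxx.
Qed.

Lemma random_compact_bigcap (K : nat -> Omega -> set X) :
    (forall n, random_compact (K n)) -> (forall n w, K n.+1 w `<=` K n w) ->
  random_compact (fun w => \bigcap_n K n w).
Proof.
move=> rK Kd; have Kc n w : compact (K n w) by exact: random_compact_compact.
have K0 n w := random_compact_neq0 (rK n) w.
split => [w|w|g cg].
- apply: (@subclosed_compact _ _ (K 0%N w)) => //; last first.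
    by move=> x; apply.
  apply: closed_bigI => n _; apply: compact_closed (Kc n w).
  exact: metric_hausdorff.
- by apply: bigcap_decreasing_neq0 => n; [exact: Kc|exact: K0|exact: Kd].
- apply: (@measurable_fun_cvg _ _ _ _ (fun n w => infval (g w) (K n w))).
    by move=> n; exact: random_compact_infval.
  move=> w _; apply: (@infval_bigcap_cvg _ _ (fun n => K n w)) => //.
    exact: caratheodory_ge0.
  exact: caratheodory_continuous.
Qed.

(** Measurability is stated through distances, which is the form that the
infima of distance functions provide; [measurable_fun_mdist] and
[measurable_mdist] relate it to the Borel sigma-algebra. *)
Record random_map (f : Omega -> X -> X) : Prop := {
  random_map_continuous : forall w, continuous (f w);
  random_map_measurable : forall z x,
    measurable_fun setT (fun w => mdist z (f w x)) }.

Lemma caratheodory_random_map g f : caratheodory g -> random_map f ->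
  caratheodory (fun w x => g w (f w x)).
Proof.
move=> cg [fc mf]; split => [w x|x|w x]; last exact: caratheodory_ge0.
  apply: (@continuous_comp _ _ _ (f w)); first exact: fc.
  exact: caratheodory_continuous.
by apply: caratheodory_comp => // z; exact: mf.
Qed.

Lemma random_compact_image K f : random_compact K -> random_map f ->
  random_compact (fun w => f w @` K w).
Proof.
move=> [Kc K0 mK] rf; split => [w|w|g cg].
- apply: continuous_compact (Kc w); apply: continuous_subspaceT.
  exact: random_map_continuous.
- by have [x Kx] := K0 w; exists (f w x), x.
- apply: eq_measurable_fun (mK _ (caratheodory_random_map cg rf)) => w _.
  by rewrite /infval image_comp.
Qed.

(** Minimizing the distances to [a 0], [a 1], ... in turn leaves points that
have the same distance to every [a k], hence a single point. Its distance to
[x] is an infimum over a random compact set, which makes it measurable. *)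
Lemma random_compact_selection K : random_compact K ->
  exists2 y, (forall w, K w (y w)) &
    forall x, measurable_fun setT (fun w => mdist x (y w)).
Proof.
move=> rK.
pose fix J k : Omega -> set X := if k is k'.+1 then
  fun w => [set x | J k' w x /\ mdist (a k') x = infval (mdist (a k')) (J k' w)]
  else K.
have rJ k : random_compact (J k).
  elim: k => //= k IH; apply: random_compact_argmin IH _.
  exact: caratheodory_mdist.
have Jd k w : J k.+1 w `<=` J k w by move=> x [].
have rI := random_compact_bigcap rJ Jd.
have Isub w x z : (\bigcap_k J k w) x -> (\bigcap_k J k w) z -> x = z.
  move=> Jx Jz; apply/eqP; rewrite -[_ == _]negbK -mdist_gt0; apply/negP => xz.
  have [k] : exists k, mdist x (a k) < mdist x z / 2.
    apply: (@dense_near x [set b | mdist x b < mdist x z / 2]).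
    have : \forall b \near x, ball x (mdist x z / 2) b.
      by apply: nbhsx_ballx; rewrite divr_gt0.
    by apply: filterS => b; rewrite ballEmdist.
  have [_ kx] := Jx k.+1 I; have [_ kz] := Jz k.+1 I.
  have := metric_triangle x (a k) z; rewrite (metric_sym x (a k)) kx -kz; lra.
have [y Iy] := choice (random_compact_neq0 rI).
exists y => [w|x]; first exact: (Iy w 0%N).
have := random_compact_infval rI (caratheodory_mdist x).
apply: eq_measurable_fun => w _.
rewrite (_ : \bigcap_k J k w = [set y w]) /infval ?image_set1 ?inf1//.
by apply/seteqP; split => [z Iz|_ ->//]; exact: Isub Iz (Iy w).
Qed.

(** An open [U] is the set where the distance to its complement is positive,
and this distance is a Caratheodory function. *)
Lemma measurable_fun_mdist y :
    (forall x, measurable_fun setT (fun w => mdist x (y w))) ->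
  measurable_fun setT (y : Omega -> borel X).
Proof.
move=> my; apply: (@measurability _ _ Omega (borel X) setT y (@open X)) => //.
move=> _ [U oU <-].
have [->|UT] := eqVneq U setT; first by rewrite preimage_setT setIT.
have U0 : ~` U !=set0.
  by apply/set0P; apply: contra UT => /eqP; rewrite -setCT => /setC_inj ->.
have cU : caratheodory (fun (_ : Omega) x => dist_set x (~` U)).
  split => [_|x|_ x]; [|exact: measurable_cst|exact: dist_set_ge0].
  apply: lip_continuous => x z; rewrite -lerBlDr; apply: le_infval => // b Ub.
  rewrite lerBlDr (le_trans (dist_set_le _ Ub))// addrC (metric_sym x z).
  exact: metric_triangle.
rewrite setTI (_ : y @^-1` U =
    (fun w => dist_set (y w) (~` U)) @^-1` `]0, +oo[).
  rewrite -[X in measurable X]setTI.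
  by apply: (caratheodory_comp cU my) => //; exact: measurable_itv.
apply/seteqP; split => w /=; rewrite in_itv/= andbT.
  move=> Uy; have : nbhs (y w) U by exact: open_nbhs_nbhs.
  move=> /nbhs_ballP[r /= r0 rU].
  apply: (lt_le_trans r0); apply: le_infval => // b Ub; rewrite leNgt.
  by apply/negP => yb; apply: Ub; apply: rU; rewrite ballEmdist.
move=> y0; apply: contrapT => Uy; have := @dist_set_le (y w) (y w) (~` U) Uy.
by rewrite mdistxx leNgt y0.
Qed.

Lemma measurable_mdist y : measurable_fun setT (y : Omega -> borel X) ->
  forall x, measurable_fun setT (fun w => mdist x (y w)).
Proof.
move=> my x.
apply: (@measurableT_comp _ _ _ _ (borel X) _ (mdist x : borel X -> R)) => //.
apply: (measurability _ (RGenOpens.measurableE R)) => _ [_ [b [c ->] <-]].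
rewrite setTI; apply: sub_sigma_algebra.
by have /continuousP := @mdist_continuous _ X x; apply; exact: itv_open.
Qed.

End random_compact.

(** * Measurable inverse limits *)

Section inverse_limit.
Context {R : realType} {d : measure_display} {Omega : measurableType d}.
Context {X : completeMetricType R} {a : nat -> X}.
Hypothesis dense_a : dense (range a).
Local Open Scope ring_scope.

Section core.
Variables (A : nat -> Omega -> set X) (f : nat -> Omega -> X -> X).
Hypothesis rA : forall n, random_compact (A n).
Hypothesis rf : forall n, random_map (f n).
Hypothesis fA : forall n w, f n w @` A n.+1 w `<=` A n w.

(** [iterated_image k n w] is the image of [A (n + k) w] in [A n w]. *)
Fixpoint iterated_image (k n : nat) (w : Omega) : set X :=
  if k is k'.+1 then f n w @` iterated_image k' n.+1 w else A n w.

Definition inverse_limit_core n w := \bigcap_k iterated_image k n w.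

Lemma random_compact_iterated_image k n : random_compact (iterated_image k n).
Proof.
by elim: k n => //= k IH n; exact: (random_compact_image dense_a (IH n.+1)).
Qed.

Lemma iterated_image_decreasing k n w :
  iterated_image k.+1 n w `<=` iterated_image k n w.
Proof.
elim: k n => [n|k IH n]; first exact: fA.
by apply: image_subset; exact: IH.
Qed.

Lemma random_compact_core n : random_compact (inverse_limit_core n).
Proof.
apply: random_compact_bigcap => [k|k w].
  exact: random_compact_iterated_image.
exact: iterated_image_decreasing.
Qed.

(** Compactness is what makes the transition maps onto: the fibres of [z] in
the decreasing sets [iterated_image k n.+1 w] are nonempty and compact, so they
have a common point. *)
Lemma core_surjective n w :
  inverse_limit_core n w `<=` f n w @` inverse_limit_core n.+1 w.
Proof.
move=> z Iz.
pose K k := iterated_image k n.+1 w `&` f n w @^-1` [set z].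
have [||k|x Ix] := @bigcap_decreasing_neq0 _ _ K.
- move=> k; apply: compact_closedI.
    exact: (random_compact_compact (random_compact_iterated_image k n.+1)).
  apply: closed_comp.
    by move=> x _; exact: (random_map_continuous (rf n)).
  apply: accessible_closed_set1; apply: hausdorff_accessible.
  exact: metric_hausdorff.
- by move=> k; have [x Cx xz] := Iz k.+1 I; exists x.
- by move=> x [Cx xz]; split => //; exact: iterated_image_decreasing.
exists x; first by move=> k _; have [] := Ix k I.
by have [] := Ix 0%N I.
Qed.

End core.

(** The recursion stays inside the cores because a point of [A n w] may have no
preimage; a point of the core has one, again in the core. *)
Theorem measurable_inverse_limit (A : nat -> Omega -> set X)
    (f : nat -> Omega -> X -> X) :
    (forall n, random_compact (A n)) -> (forall n, random_map (f n)) ->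
    (forall n w, f n w @` A n.+1 w `<=` A n w) ->
  exists y : nat -> Omega -> X,
    [/\ forall n, measurable_fun setT (y n : Omega -> borel X),
        forall n w, A n w (y n w)
      & forall n w, f n w (y n.+1 w) = y n w].
Proof.
move=> rA rf fA; pose I_ := inverse_limit_core A f.
have rI := random_compact_core rA rf fA.
pose point n (y : Omega -> X) := (forall w, I_ n w (y w)) /\
  forall x, measurable_fun setT (fun w => mdist x (y w)).
have step (p : nat * (Omega -> X)) : exists y', point p.1 p.2 ->
    point p.1.+1 y' /\ forall w, f p.1 w (y' w) = p.2 w.
  case: p => n y/=; have [[Iy my]|py] := pselect (point n y); last by exists y.
  (* The distance from [f n w x] to the previous point reaches 0 on the core,
     so its minimizers are exactly the preimages of that point. *)
  have cy : caratheodory (fun w => mdist (y w)).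
    split => [w|x|w x]; [exact: mdist_continuous| |exact: mdist_ge0].
    by apply: eq_measurable_fun (my x) => w _; rewrite metric_sym.
  have cg := caratheodory_random_map dense_a cy (rf n).
  have [y' Jy' my'] := random_compact_selection dense_a
    (random_compact_argmin (rI n.+1) cg).
  exists y' => _; split; first by split => // w; have [] := Jy' w.
  move=> w; have [Iy' fy'] := Jy' w; apply/esym/mdist_positivity.
  rewrite fy'; apply/eqP; rewrite eq_le; apply/andP; split; last first.
    by apply: le_infval => [|x _]; [exists (y' w)|exact: mdist_ge0].
  have [x Ix xy] := core_surjective rA rf fA (Iy w).
  apply: le_trans (infval_le (caratheodory_ge0 cg w) Ix) _.
  by rewrite xy mdistxx.
have [g gP] := choice step.
have [y0 Iy0 my0] := random_compact_selection dense_a (rI 0%N).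
pose fix y n := if n is n'.+1 then g (n', y n') else y0.
have yP n : point n (y n) by elim: n => // n /(gP (n, y n))[].
exists y; split => [n|n w|n w].
- by apply: (measurable_fun_mdist dense_a); have [] := yP n.
- by have [/(_ w)/(_ 0%N I)] := yP n.
- by have [_ ->] := gP (n, y n) (yP n).
Qed.

End inverse_limit.

(** * Measures carried by the graph of a random point *)

Section graph_measure.
Context {R : realType} {d : measure_display} {Omega : measurableType d}.
Context {P : probability Omega R} {X : completeMetricType R}.
Hypothesis sepX : separable X.

Lemma separable_seq : exists a : nat -> X, dense (range a).
Proof.
have [D cD dD] := sepX; have [a Da] := pcard_surjP cD.
exists a => O O0 oO; have [x [Ox Dx]] := dD O O0 oO.
by exists x; split => //; exact: Da.
Qed.

(** Balls of radius [j.+1%:R^-1] around the points of a dense sequence. *)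
Lemma separating_sets : exists B : nat -> set (borel X),
  (forall k, measurable (B k)) /\
  forall x y : X, x <> y -> exists k, B k x /\ ~ B k y.
Proof.
have [a da] := separable_seq.
pose B k : set (borel X) := if unpickle k is Some ij then
  [set x : X | (mdist (a ij.1) x < ij.2.+1%:R^-1)%R] else set0.
exists B; split => [k|x y xy].
  rewrite /B; case: unpickle => [[i j]|]; last exact: measurable0.
  apply: sub_sigma_algebra => /=.
  have /continuousP cm := @mdist_continuous R X (a i).
  exact: (cm [set r | r < j.+1%:R^-1]%R (@open_lt R _)).
have xy0 : (0 < mdist x y / 2)%R by rewrite divr_gt0// mdist_gt0; exact/eqP.
have [j jxy] : exists j, (j.+1%:R^-1 < mdist x y / 2)%R.
  have [j _ /(_ j (leqnn _)) jxy] := near_infty_natSinv_lt (PosNum xy0).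
  by exists j.
have [i xi] : exists i, (mdist x (a i) < j.+1%:R^-1)%R.
  apply: (dense_near da (P := fun b => mdist x b < j.+1%:R^-1)%R).
  have : \forall b \near x, ball x (j.+1%:R^-1 : R)%R b by exact: nbhsx_ballx.
  by apply: filterS => b; rewrite ballEmdist.
exists (pickle (i, j)); rewrite /B pickleK/=; split.
  by rewrite metric_sym.
move=> /= yi; have := metric_triangle x (a i) y; rewrite leNgt => /negP; apply.
rewrite [ltRHS]splitr; apply: ltrD; first exact: lt_trans xi jxy.
exact: lt_trans yi jxy.
Qed.

Section one_point.
Variables (y : Omega -> borel X) (my : measurable_fun setT y).

(** The proof of measurability is an argument so that the canonical instance
below can find it. *)
Definition graph_map & measurable_fun setT y := fun w => (w, y w).

Let measurable_graph_map : measurable_fun setT (graph_map my).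
Proof. exact: measurable_fun_pair. Qed.

HB.instance Definition _ := isMeasurableFun.Build _ _ _ _ (graph_map my)
  measurable_graph_map.

Definition graph_measure : probability (Omega * borel X)%type R :=
  distribution P (graph_map my).

(** The complement of the graph is covered by countably many rectangles
[y @^-1` (~` B k) `*` B k], and none of them meets the graph. *)
Lemma graph_measure_negligible :
  graph_measure.-negligible [set z | z.2 <> y z.1].
Proof.
have [B [mB sepB]] := separating_sets.
apply: (@negligibleS _ _ _ _ (\bigcup_k (y @^-1` (~` B k) `*` B k))).
  by move=> [w x]/= /sepB[k [Bx By]]; exists k.
apply: negligible_bigcup => k.
have mk : measurable (y @^-1` (~` B k)).
  by rewrite -[X in measurable X]setTI; apply: my => //; exact: measurableC.
apply/negligibleP; first exact: measurableX.
transitivity (P set0); last exact: measure0.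
by congr (P _); rewrite -subset0 => w [].
Qed.

Lemma disintegration_kdirac : disintegration P graph_measure (kdirac my).
Proof.
move=> A B mA mB; rewrite /graph_measure /distribution /pushforward.
have myB : measurable (y @^-1` B).
  by rewrite -[X in measurable X]setTI; exact: my.
transitivity (P ((A `&` y @^-1` B) `&` setT)); first by rewrite setIT.
rewrite -integral_indic//; last exact: measurableI.
by apply: eq_integral => w _; rewrite indicI/= EFinM.
Qed.

(** On the rectangle [y @^-1` (~` B k) `*` B k], which is null, the
disintegration formula says that [m w] does not charge [B k] for almost every
[w] with [y w] outside [B k]; the complement of [[set y w]] is covered by such
sets. *)
Lemma disintegration_graph (m : R.-pker Omega ~> borel X) :
  disintegration P graph_measure m ->
  {ae P, forall w, (m w).-negligible (~` [set y w])}.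
Proof.
move=> dm; have [B [mB sepB]] := separating_sets.
have : {ae P, forall w, forall k, ~ B k (y w) -> m w (B k) = 0}.
  apply: ae_foralln => k.
  have mk : measurable (y @^-1` (~` B k)).
    by rewrite -[X in measurable X]setTI; apply: my => //; exact: measurableC.
  pose f w := (\1_(y @^-1` (~` B k)) w)%:E * m w (B k).
  have mf : measurable_fun setT f.
    apply: emeasurable_funM; last exact: measurable_kernel.
    by apply/measurable_EFinP; exact: measurable_indic.
  have f0 w : 0 <= f w by rewrite mule_ge0// lee_fin.
  have : \int[P]_w `|f w| = 0.
    under eq_integral do rewrite gee0_abs//.
    rewrite -dm//; transitivity (P set0); last exact: measure0.
    by congr (P _); rewrite -subset0 => w [].
  move=> /(ae_eq_integral_abs P measurableT mf).
  apply: filterS => w /(_ I) fw nB; move: fw.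
  by rewrite /f indicE mem_set// mul1e.
apply: filterS => w mw.
apply: (@negligibleS _ _ _ _ (\bigcup_k (B k `&` [set _ | ~ B k (y w)]))).
  by move=> x /sepB[k [Bx By]]; exists k.
apply: negligible_bigcup => k; have [Bk|nBk] := pselect (B k (y w)).
  by apply: (@negligibleS _ _ _ _ set0) => [x []//|]; exact: negligible_set0.
apply: (@negligibleS _ _ _ _ (B k)) => [x []//|].
by apply/negligibleP; last exact: mw.
Qed.

End one_point.
End graph_measure.

Arguments graph_measure {R d Omega} P {X y} my.

Section point_system.
Context {R : realType} {d : measure_display} {Omega : measurableType d}.
Context {P : probability Omega R} {X : completeMetricType R}.
Hypothesis sepX : separable X.

(** Almost surely for [graph_measure P (my s)], a pair is [(w, y s w)], which
the flow sends to [(w, y t w)]; this gives the measurable representative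
[z |-> (z.1, y t z.1)] of the transport map. *)
Lemma evolution_system_graph (S : R -> R -> Omega -> X -> X)
    (y : R -> Omega -> borel X) (my : forall t, measurable_fun setT (y t)) :
    (forall s t : R, (s <= t)%R -> {ae P, forall w, S t s w (y s w) = y t w}) ->
  evolution_system P S (fun t => graph_measure P (my t)).
Proof.
move=> Sy; split=> [//|s t st].
exists (fun z => (z.1, y t z.1)); split => [||//].
  by apply: measurable_fun_pair => //; exact: measurableT_comp.
have [N [mN PN0 SN]] := Sy s t st.
apply: (@negligibleS _ _ _ _
    ([set z | z.2 <> y s z.1] `|` N `*` [set: borel X])).
  move=> z/= Sz; have [zy|] := eqVneq z.2 (y s z.1); last by move=> /eqP; left.
  by right; split => //; apply: SN => /= Syt; apply: Sz; rewrite zy Syt.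
apply: negligibleU; first exact: graph_measure_negligible.
apply/negligibleP; first exact: measurableX.
transitivity (P N); last by [].
by congr (P _); apply/seteqP; split => [w []|w Nw].
Qed.

Lemma supported_by_graph (y : Omega -> borel X) (my : measurable_fun setT y)
    (A : Omega -> set X) :
    {ae P, forall w, measurable (A w : set (borel X)) /\ A w (y w)} ->
  supported_by P (graph_measure P my) A.
Proof.
move=> Ay; split=> [|m].
  by exists (kdirac my); exact: disintegration_kdirac.
move=> /(disintegration_graph sepX); apply: filterS2 Ay => w [mA Ayw] mw.
have mCA : m w (~` A w) = 0.
  apply: measure_negligible; first exact: (@measurableC _ (borel X)).
  by apply: negligibleS mw => x /= nAx xy; apply: nAx; rewrite xy.
have := prob_kernel (s := m) w.
rewrite -(setUv (A w)) measureU//; last 2 first.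
- exact: (@measurableC _ (borel X)).
- exact: setICr.
by rewrite [X in _ + X]mCA adde0.
Qed.

Lemma compact_borel (K : set X) : compact K -> measurable (K : set (borel X)).
Proof.
move=> Kc; have cK : closed K.
  by apply: compact_closed Kc; exact: metric_hausdorff.
rewrite -[K]setCK.
apply: (@measurableC _ (borel X)); apply: sub_sigma_algebra.
exact: closed_openC.
Qed.

End point_system.

(** * Stochastic flows *)

Section flow.
Context {R : realType} {d : measure_display} {Omega : measurableType d}.
Context {P : probability Omega R} {X : completeMetricType R}.
Variables (S : R -> R -> Omega -> X -> X) (flowS : stochastic_flow P S).

Lemma flow_measurable_omega (s t : R) (x : X) : (s <= t)%R ->
  measurable_fun setT (fun w => S t s w x : borel X).
Proof.
move=> st.
apply: (@measurable_comp _ _ _ _ _ _ (`]-oo, t] `*` setT)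
  (fun p : R * Omega => S t p.1 p.2 x : borel X) setT (fun w => (s, w))).
- by apply: measurableX => //; exact: measurable_itv.
- by move=> _ [w _ <-]; split => //=; rewrite in_itv.
- exact: (flow_measurable flowS).
- exact: pair1_measurable.
Qed.

End flow.

Theorem theorem3p2 (R : realType) (d : measure_display)
    (Omega : measurableType d) (P : probability Omega R)
    (X : completeMetricType R) (sepX : separable X)
    (S : R -> R -> Omega -> X -> X) (flowS : stochastic_flow P S)
    (A : R -> Omega -> set X) (A_neq0 : forall t w, A t w !=set0)
    (Omega0 : set Omega) (mOmega0 : measurable Omega0) (POmega0 : P Omega0 = 1)
    (A_meas : forall (x : X) (t : R),
       measurable_fun setT (fun w => dist_set x (A t w)))
    (A_compact : forall w t, Omega0 w -> compact (A t w))
    (A_invariant : forall w (s t : R), Omega0 w -> (s <= t)%R ->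
       S t s w @` A s w `<=` A t w) :
  exists mu : R -> probability (Omega * borel X)%type R,
    evolution_system P S mu /\
    forall t : R, supported_by P (mu t) (A t).
Proof.
have [a da] := separable_seq sepX.
have [N [mN PN0 flowN]] := flow_ae flowS.
pose G := Omega0 `\` N.
have mG : measurable G by exact: measurableD.
have PG : P.-negligible (~` G).
  rewrite /G setDE setCI setCK; apply: negligibleU; last by apply/negligibleP.
  apply/negligibleP; first exact: measurableC.
  transitivity (1 - P Omega0); first exact: probability_setC.
  by rewrite POmega0 subee.
have flowG w : G w -> [/\ forall s r t : R, (s <= r)%R -> (r <= t)%R ->
          S t r w \o S r s w = S t s w,
        forall s t : R, (s <= t)%R -> continuous (S t s w)
      & forall t : R, S t t w = id].
  by move=> [_ Nw]; apply: contrapT => Fw; apply: Nw; exact: flowN.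
have mGb : measurable_fun setT (fun w => w \in G).
  apply: (measurable_fun_bool true); rewrite setTI.
  rewrite (_ : _ @^-1` _ = G)//.
  by apply/seteqP; split => w /=; [exact: set_mem|exact: mem_set].
(* On the null set of bad [w] the flow is replaced by the identity and the
   random sets by a fixed point, so that the inverse limit theorem, which
   assumes its hypotheses for every [w], applies. *)
pose S' t s w : X -> X := if w \in G then S t s w else id.
pose A' t w : set X := if w \in G then A t w else [set point].
have S'E t s w : G w -> S' t s w = S t s w by move=> Gw; rewrite /S' mem_set.
have A'E t w : G w -> A' t w = A t w by move=> Gw; rewrite /A' mem_set.
have rS' s t : (s <= t)%R -> random_map (S' t s).
  move=> st; split => [w|z x].
    rewrite /S'; case: ifPn => [/set_mem/flowG[_ + _]|_]; first exact.
    by move=> x; exact: cvg_id.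
  apply: measurable_mdist; rewrite /S'.
  rewrite (_ : (fun w => _) =
    fun w => if w \in G then S t s w x : borel X else x).
    apply: measurable_fun_ifT => //; exact: (flow_measurable_omega flowS).
  by apply/funext => w; case: ifP.
have rA' t : random_compact (A' t).
  apply: (random_compact_dist da) => [w|w|x]; rewrite /A'.
  - case: ifPn => [/set_mem [Gw _]|_]; [exact: A_compact|exact: compact_set1].
  - by case: ifPn => // _; exists point.
  - rewrite (_ : (fun w => _) = fun w => if w \in G then dist_set x (A t w)
      else dist_set x [set point]).
      by apply: measurable_fun_ifT.
    by apply/funext => w; case: ifP.
pose T (n : nat) : R := (- n%:R)%R.
have Tle m n : (m <= n)%N -> (T n <= T m)%R by rewrite /T lerN2 ler_nat.
have [y [my Ay Sy]] : exists y : nat -> Omega -> X,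
    [/\ forall n, measurable_fun setT (y n : Omega -> borel X),
        forall n w, A' (T n) w (y n w)
      & forall n w, S' (T n) (T n.+1) w (y n.+1 w) = y n w].
  apply: (measurable_inverse_limit da (A := fun n => A' (T n))
    (f := fun n => S' (T n) (T n.+1))) => [n|n|n w]; first exact: rA'.
    by apply: rS'; exact: Tle.
  have [Gw|nGw] := pselect (G w).
    by rewrite S'E// !A'E//; apply: A_invariant; [case: Gw|exact: Tle].
  by rewrite /S' /A' memNset//= => _ [x -> <-].
(* The trajectory indexed by the nonpositive integers is transported forward to
   an arbitrary real time from any sufficiently early integer time. *)
pose N_ (t : R) : nat := Num.bound `|t|%R.
have N_le t : (T (N_ t) <= t)%R.
  rewrite /T lerNl; apply: (le_trans (ler_norm _)); rewrite normrN.
  exact: ltW (archi_boundP (normr_ge0 t)).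
pose Y t w : borel X := S' t (T (N_ t)) w (y (N_ t) w).
have mY t : measurable_fun setT (Y t).
  apply: (measurable_fun_mdist da) => x.
  have cx := caratheodory_random_map da (caratheodory_mdist x)
    (rS' _ _ (N_le t)).
  by apply: (caratheodory_comp da cx); exact: measurable_mdist.
have back w m n : G w -> (m <= n)%N -> S (T m) (T n) w (y n w) = y m w.
  move=> Gw; have [Sc _ Sid] := flowG w Gw.
  elim: n => [|n IH]; first by rewrite leqn0 => /eqP ->; rewrite Sid.
  rewrite leq_eqVlt => /predU1P[->|]; first by rewrite Sid.
  rewrite ltnS => mn; rewrite -(Sc _ (T n))/=; [|exact: Tle|exact: Tle].
  by have := Sy n w; rewrite S'E// => ->; exact: IH.
have YE w t n : G w -> (T n <= t)%R -> Y t w = S t (T n) w (y n w).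
  move=> Gw nt; have [Sc _ _] := flowG w Gw; rewrite /Y S'E//.
  have [le|/ltnW le] := leqP n (N_ t).
    by rewrite -(back w _ _ Gw le) -(Sc (T (N_ t)) (T n) t)//; exact: Tle.
  by rewrite -(back w _ _ Gw le) -(Sc (T n) (T (N_ t)) t)//; exact: Tle.
exists (fun t => graph_measure P (mY t)); split=> [|t].
  apply: (evolution_system_graph sepX) => s t st.
  apply: negligibleS PG => w /= nS Gw; apply: nS.
  have [Sc _ _] := flowG w Gw.
  rewrite (YE w s (N_ s))// (YE w t (N_ s))//; last exact: le_trans (N_le s) st.
  by rewrite -(Sc (T (N_ s)) s t).
apply: (supported_by_graph sepX).
apply: negligibleS PG => w /= nA Gw; apply: nA.
split; first by apply: compact_borel; apply: A_compact; case: Gw.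
rewrite /Y S'E//; apply: (A_invariant w (T (N_ t)) t) => //; first by case: Gw.
by exists (y (N_ t) w) => //; rewrite -A'E//; exact: Ay.
Qed.
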